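(* Let $H\subset SU(2)$ be a nilpotent subgroup. Then either $H$ is abelian or there exist an integer $r\ge 2$ and an element $g\in SU(2)$ such that \[gHg^{-1}=Q_{2^{r+1}}.\]
   Context: Let $\xi_n=\begin{pmatrix} e^{2\pi i/n}&0\\0&e^{-2\pi i/n}\end{pmatrix}$, let $\mu_n$ be the cyclic subgroup of $SU(2)$ generated by $\xi_n$, and let $w=\begin{pmatrix}0&-1\\1&0\end{pmatrix}$. The generalized quaternion group is the subgroup $Q_{2^{r+1}}=\mu_{2^{r}}\cup w\mu_{2^{r}}$ of $SU(2)$, of order $2^{r+1}$. *)

(* Defs.v *)
From HB Require Import structures.
From mathcomp Require Import all_boot all_order all_algebra.
From mathcomp Require Import spectral.
From mathcomp Require Import complex.
From mathcomp Require Import boolp classical_sets reals exp trigo.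

Set Implicit Arguments.
Unset Strict Implicit.
Unset Printing Implicit Defensive.

Import GRing.Theory Num.Theory.
Local Open Scope classical_set_scope.
Local Open Scope ring_scope.

Section Subgroups.
Variable G : groupType.
Local Open Scope group_scope.
Implicit Types A B H : set G.

Definition subgroup H : Prop := group_closed [in H].

Definition generated A : set G := smallest subgroup A.

Definition commutator_subgroup A B : set G :=
  generated [set [~ a, b] | a in A & b in B].

(* [lower_central H 0] is H itself, so the class of a nilpotent H is at most n
   when [lower_central H n] is trivial. *)
Definition lower_central H (n : nat) : set G :=
  iter n (fun K => commutator_subgroup K H) H.

Definition nilpotent_subgroup H : Prop :=
  exists n : nat, lower_central H n = [set 1].

Definition abelian_subgroup H : Prop := {in H &, forall x y, commute x y}.

(* g H g^-1; the library's [h ^ g] is the opposite convention g^-1 h g. *)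
Definition conj_image (g : G) H : set G := [set g * h * g^-1 | h in H].

End Subgroups.

Section SpecialUnitary.
Variables (C : numClosedFieldType) (n : nat).
Local Open Scope sesquilinear_scope.

Record SU := MkSU {
  SU_mx :> 'M[C]_n;
  _ : (SU_mx \is unitarymx) && (\det SU_mx == 1)
}.

HB.instance Definition _ := [isSub for SU_mx].
HB.instance Definition _ := [Choice of SU by <:].

Lemma SU_unitary (A : SU) : A *m (A : 'M_n)^t* = 1%:M.
Proof. by case: A => A /= /andP[/unitarymxP]. Qed.

Lemma SU_det (A : SU) : \det A = 1.
Proof. by case: A => A /= /andP[_ /eqP]. Qed.

Fact SU_one_subproof : (1%:M \is @unitarymx C n n) && (\det (1%:M : 'M[C]_n) == 1).
Proof.
by rewrite det1 eqxx andbT; apply/unitarymxP; rewrite trmx1 map_mx1 mulmx1.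
Qed.

Fact SU_mul_subproof (A B : SU) :
  (A *m B \is unitarymx) && (\det (A *m B) == 1).
Proof.
by rewrite det_mulmx !SU_det mulr1 eqxx andbT mul_unitarymx //;
  apply/unitarymxP/SU_unitary.
Qed.

Fact SU_inv_subproof (A : SU) :
  (invmx A \is unitarymx) && (\det (invmx A) == 1).
Proof.
have uA : (A : 'M_n) \is unitarymx by apply/unitarymxP/SU_unitary.
by rewrite det_inv SU_det invr1 eqxx andbT invmx_unitary// trmxC_unitary.
Qed.

Definition SU_one : SU := MkSU SU_one_subproof.
Definition SU_mul (A B : SU) : SU := MkSU (SU_mul_subproof A B).
Definition SU_inv (A : SU) : SU := MkSU (SU_inv_subproof A).

Fact SU_mulA : associative SU_mul.
Proof. by move=> A B D; apply/val_inj; rewrite /= mulmxA. Qed.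
Fact SU_mul1 : left_id SU_one SU_mul.
Proof. by move=> A; apply/val_inj; rewrite /= mul1mx. Qed.
Fact SU_mulr1 : right_id SU_one SU_mul.
Proof. by move=> A; apply/val_inj; rewrite /= mulmx1. Qed.

Fact SU_unitmx (A : SU) : (A : 'M_n) \in unitmx.
Proof. exact/unitarymx_unit/unitarymxP/SU_unitary. Qed.

Fact SU_mulV : left_inverse SU_one SU_inv SU_mul.
Proof. by move=> A; apply/val_inj; rewrite /= mulVmx ?SU_unitmx. Qed.
Fact SU_mulrV : right_inverse SU_one SU_inv SU_mul.
Proof. by move=> A; apply/val_inj; rewrite /= mulmxV ?SU_unitmx. Qed.

HB.instance Definition _ :=
  isGroup.Build SU SU_mulA SU_mul1 SU_mulr1 SU_mulV SU_mulrV.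

End SpecialUnitary.

Section Quaternion.
Variable R : realType.
Local Open Scope complex_scope.
Local Open Scope sesquilinear_scope.

Definition mx2 (a b c d : R[i]) : 'M[R[i]]_2 :=
  \matrix_(i, j) if i == 0 then (if j == 0 then a else b)
                 else (if j == 0 then c else d).

(* e^{i t} for real t *)
Definition expi (t : R) : R[i] := cos t +i* sin t.

Definition xi_mx (n : nat) : 'M[R[i]]_2 :=
  mx2 (expi (2 * pi / n%:R)) 0 0 (expi (- (2 * pi / n%:R))).

Definition w_mx : 'M[R[i]]_2 := mx2 0 (- 1) 1 0.

Lemma det_mx2 (a b c d : R[i]) : \det (mx2 a b c d) = a * d - b * c.
Proof.
rewrite (expand_det_row _ 0) !big_ord_recl big_ord0 addr0 /cofactor !det_mx11.
by rewrite !mxE /= expr0 expr1 mul1r mulN1r mulrN.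
Qed.

Lemma mx2_unitary (a b c d : R[i]) :
  a * a^* + b * b^* = 1 -> a * c^* + b * d^* = 0 ->
  c * a^* + d * b^* = 0 -> c * c^* + d * d^* = 1 ->
  mx2 a b c d \is unitarymx.
Proof.
move=> h00 h01 h10 h11; apply/unitarymxP/matrixP => i j.
rewrite !mxE !big_ord_recl big_ord0 addr0 !mxE /=.
by case: i j => [[|[|//]]] ? [[|[|//]]] ?; rewrite /= ?h00 ?h01 ?h10 ?h11.
Qed.

Fact xi_subproof (n : nat) :
  (xi_mx n \is unitarymx) && (\det (xi_mx n) == 1).
Proof.
have expiV t : expi t * expi (- t) = 1.
  rewrite /expi cosN sinN; apply/eqP; rewrite eq_complex /=.
  by rewrite !mulrN opprK -!expr2 cos2Dsin2 addrC mulrC subrr !eqxx.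
have expiJ t : Num.conj (expi t) = expi (- t).
  by rewrite /expi cosN sinN.
rewrite det_mx2 mulr0 subr0 expiV eqxx andbT.
apply: mx2_unitary; rewrite !(mulr0, mul0r, conjC0, addr0, add0r) //.
  by rewrite expiJ expiV.
by rewrite expiJ expiV.
Qed.

Fact w_subproof : (w_mx \is unitarymx) && (\det w_mx == 1).
Proof.
rewrite det_mx2 mul0r mulN1r opprK add0r eqxx andbT.
apply: mx2_unitary; rewrite ?(mulr0, mul0r, conjC0, addr0, add0r) //.
  by rewrite rmorphN rmorph1 mulrNN mulr1.
by rewrite rmorph1 mulr1.
Qed.

Definition xi (n : nat) : SU R[i] 2 := MkSU (xi_subproof n).

Definition w : SU R[i] 2 := MkSU w_subproof.

Definition mu (n : nat) : set (SU R[i] 2) := generated [set xi n].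

(* [gen_quaternion r] is Q_{2^{r+1}}: the index is the exponent of the cyclic
   part, not the order of the group. *)
Definition gen_quaternion (r : nat) : set (SU R[i] 2) :=
  mu (2 ^ r) `|` [set (w * x)%g | x in mu (2 ^ r)].

End Quaternion.

(* Main.v *)
(* In a nonabelian nilpotent H some x is noncentral with all [x, k] central.
   Central elements of a nonabelian subgroup of SU(2) are scalar, hence +-1, so
   after diagonalising x every k in H commutes or anticommutes with x, i.e. is
   diagonal or antidiagonal.  An antidiagonal element of H exists, is conjugate
   to w by a diagonal matrix, and inverts the diagonal part of H.  Nilpotency then
   forces that part to have exponent a power of 2, so it is mu_(2^r).  Since some
   k anticommutes with x, x^2 = -1, whence r >= 2. *)
Require Import Defs.
From mathcomp Require Import all_boot all_order all_algebra.
From mathcomp Require Import spectral ring.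
From mathcomp Require Import complex boolp classical_sets reals exp trigo.

Set Implicit Arguments.
Unset Strict Implicit.
Unset Printing Implicit Defensive.

Import GRing.Theory Num.Theory.
Local Open Scope classical_set_scope.
Local Open Scope ring_scope.

(** * Commutator calculus in nilpotent subgroups of an abstract group *)

Section Subgroups.
Variable G : groupType.
Local Open Scope group_scope.
Implicit Types (A H : set G) (x y h : G).

Lemma subgroupP H :
  subgroup H <-> H 1 /\ forall x y, H x -> H y -> H (x * y^-1).
Proof.
split=> [[H1 HD]|[H1 HD]]; split; rewrite ?inE//.
- by move: H1; rewrite inE.
- by move=> x y Hx Hy; move: (HD x y); rewrite !inE; apply.
- by move=> x y; rewrite !inE; apply: HD.
Qed.

Lemma subgroup1 H : subgroup H -> H 1.
Proof. by move=> /subgroupP[]. Qed.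

Lemma subgroupV H x : subgroup H -> H x -> H x^-1.
Proof. by move=> /subgroupP[H1 HD] Hx; rewrite -(mul1g x^-1); apply: HD. Qed.

Lemma subgroupM H x y : subgroup H -> H x -> H y -> H (x * y).
Proof.
move=> sH Hx Hy; rewrite -(invgK y).
by apply: ((subgroupP H).1 sH).2 => //; apply: subgroupV.
Qed.

Lemma subgroupX H x n : subgroup H -> H x -> H (x ^+ n).
Proof.
move=> sH Hx; elim: n => [|n IHn]; first exact: subgroup1.
by rewrite expgS; apply: subgroupM.
Qed.

Lemma subgroup_generated A : subgroup (generated A).
Proof.
apply/subgroupP; split=> [M [/subgroup1]//|x y Ax Ay M [sM AM]].
by apply: ((subgroupP M).1 sM).2; [apply: Ax | apply: Ay].
Qed.

Lemma subgroup_set1 : subgroup [set 1 : G].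
Proof.
by apply/subgroupP; split=> [//|x y /= -> ->]; rewrite mul1g invg1.
Qed.

Lemma subgroup_lower_central H n : subgroup H -> subgroup (lower_central H n).
Proof. by case: n => // n _; apply: subgroup_generated. Qed.

Lemma lower_central_comm H n x h :
  lower_central H n x -> H h -> lower_central H n.+1 [~ x, h].
Proof. by move=> Hx Hh; apply: sub_gen_smallest; exists x => //; exists h. Qed.

Lemma lower_central_sub H n : subgroup H -> lower_central H n `<=` H.
Proof.
move=> sH; elim: n => // n IHn; apply: smallest_sub => //.
move=> _ [x /IHn Hx] [h Hh <-].
rewrite commgEl conjgE.
apply: (subgroupM sH (subgroupV sH Hx)).
exact: (subgroupM sH (subgroupV sH Hh) (subgroupM sH Hx Hh)).
Qed.

(* If h inverts b then [b, h] = b^-2, so the powers b^(2^n) sink down the lower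
   central series. *)
Lemma lower_central_inverted H n a h :
  subgroup H -> H a -> H h -> a ^ h = a^-1 ->
  lower_central H n (a ^+ (2 ^ n)).
Proof.
move=> sH Ha Hh ah; elim: n => [|n IHn]; first by rewrite expn0 expg1.
rewrite -[_ ^+ _]invgK; apply: (subgroupV (subgroup_lower_central _ sH)).
have -> : (a ^+ (2 ^ n.+1))^-1 = [~ a ^+ (2 ^ n), h].
  by rewrite commgEl conjXg ah expVgn -invgM expnSr expgnA expg2.
exact: lower_central_comm.
Qed.

(** The index at which the lower central series becomes trivial bounds all these orders at once.
    This uniform bound later makes the diagonal part of [H] finite. *)
Lemma nilpotent_inverted_torsion H :
  subgroup H -> nilpotent_subgroup H ->
  exists n, forall a h, H a -> H h -> a ^ h = a^-1 -> a ^+ (2 ^ n) = 1.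
Proof.
move=> sH [n Hn]; exists n => a h Ha Hh ah.
by have := lower_central_inverted n sH Ha Hh ah; rewrite Hn.
Qed.

(** The element [x] is taken two steps above the first trivial term of the lower central series.
    Every [[~ x, k]] then lies in the last nontrivial term, which commutes with [H]; were all of
    them trivial, that term would be generated by [1]. *)
Lemma nilpotent_second_center H :
  subgroup H -> nilpotent_subgroup H -> ~ abelian_subgroup H ->
  exists x h, [/\ H x, H h, [~ x, h] <> 1 &
    forall k l, H k -> H l -> commute [~ x, k] l].
Proof.
move=> sH [n Hn] nabH.
have : lower_central H n `<=` [set 1] by rewrite Hn.
elim: n {Hn} => [H1|n IHn Hn].
  case: nabH => x y; rewrite !inE => /H1 -> _.
  exact/commute_sym/commute1.
have [/IHn//|] := pselect (lower_central H n `<=` [set 1]).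
(* Now term [n] is nontrivial and term [n.+1] is trivial; [n = 0] would make [H] abelian. *)
case: n {IHn} Hn => [|n] Hn ntn.
  case: nabH => x y; rewrite !inE => Hx Hy; apply/commgP/eqP.
  by apply: Hn; apply: (@lower_central_comm H 0).
have [[x [h [Hx Hh xh]]]|noxh] := pselect
    (exists x h, [/\ lower_central H n x, H h & [~ x, h] <> 1]).
  exists x, h; split=> // [|k l Hk Hl]; first exact: lower_central_sub Hx.
  by apply/commgP/eqP; apply: Hn; do 2!apply: lower_central_comm => //.
case: ntn; apply: smallest_sub; first exact: subgroup_set1.
move=> _ [x Hx] [h Hh <-] /=; have [//|xh] := pselect ([~ x, h] = 1).
by case: noxh; exists x, h.
Qed.

End Subgroups.

Lemma conj_imageP (G : groupType) (g x : G) (H : set G) :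
  conj_image g H x <-> H (g^-1 * x * g)%g.
Proof.
split=> [[y Hy <-]|Hx]; first by rewrite !mulgA mulVg mul1g mulgVK.
by exists (g^-1 * x * g)%g; rewrite // !mulgA mulgV mul1g mulgK.
Qed.

Lemma subgroup_conj_image (G : groupType) (g : G) (H : set G) :
  subgroup H -> subgroup (conj_image g H).
Proof.
move=> sH; apply/subgroupP; split=> [|x y /conj_imageP Hx /conj_imageP Hy].
  by apply/conj_imageP; rewrite mulg1 mulVg; apply: subgroup1.
apply/conj_imageP; have := subgroupM sH Hx (subgroupV sH Hy).
by rewrite !invgM invgK !mulgA mulgK.
Qed.

Lemma conj_imageM (G : groupType) (g h : G) (H : set G) :
  conj_image h (conj_image g H) = conj_image (h * g)%g H.
Proof.
apply/seteqP; split=> x.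
  move=> /conj_imageP/conj_imageP Hx; apply/conj_imageP.
  by rewrite invgM !mulgA in Hx *.
by move=> /conj_imageP Hx; do 2!apply/conj_imageP; rewrite invgM !mulgA in Hx *.
Qed.

(** The order of [z] is a power of 2 dividing [2 ^ r.+1], and any smaller one would divide
    [2 ^ r]. *)
Lemma primitive_root_2X (F : fieldType) (z : F) r :
  z ^+ (2 ^ r.+1) = 1 -> z ^+ (2 ^ r) != 1 -> (2 ^ r.+1).-primitive_root z.
Proof.
move=> z1 zN1.
have [|m zm] := prim_order_exists _ z1; first by rewrite expn_gt0.
case/(dvdn_pfactor _ _ (isT : prime 2)) => k; rewrite leq_eqVlt ltnS => /orP[].
  by move=> /eqP -> <-.
move=> lekr mE; case/eqP: zN1; apply/eqP.
by rewrite -(prim_order_dvd zm) mE dvdn_exp2l.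
Qed.

Lemma ord2 (k : 'I_2) : k = 0 \/ k = 1.
Proof. by case: k => [[|[|//]]] ?; [left | right]; apply/val_inj. Qed.

(** * Diagonal and antidiagonal elements of SU(2), and diagonalization inside SU(2) *)

Section SU2.
Variable C : numClosedFieldType.
Implicit Types A B z x y : SU C 2.

Lemma SU2_mulE A B i j : (A * B)%g i j = A i 0 * B 0 j + A i 1 * B 1 j.
Proof.
rewrite [LHS]mxE !big_ord_recl big_ord0 addr0.
by congr (A _ _ * B _ _ + A _ _ * B _ _); apply/val_inj.
Qed.

Lemma SU2_det A : A 0 0 * A 1 1 - A 0 1 * A 1 0 = 1.
Proof.
rewrite -(SU_det A) (expand_det_row _ 0) !big_ord_recl big_ord0 addr0 /cofactor.
rewrite !det_mx11 !mxE /= expr0 expr1 mul1r mulN1r mulrN.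
by congr (A _ _ * A _ _ - A _ _ * A _ _); apply/val_inj.
Qed.

Lemma SU2_eq A B :
  A 0 0 = B 0 0 -> A 0 1 = B 0 1 -> A 1 0 = B 1 0 -> A 1 1 = B 1 1 -> A = B.
Proof.
move=> h00 h01 h10 h11; apply/val_inj/matrixP => i j /=.
by case: (ord2 i) => ->; case: (ord2 j) => ->.
Qed.

(** Orthonormality of the rows and determinant 1 form a linear system in the second row, solved by
    elimination. *)
Lemma SU2_conj A : A 1 1 = (A 0 0)^* /\ A 1 0 = - (A 0 1)^*.
Proof.
have /matrixP AA := SU_unitary A.
have e i j : A i 0 * (A j 0)^* + A i 1 * (A j 1)^* = (i == j)%:R.
  have := AA i j; rewrite !mxE !big_ord_recl big_ord0 addr0 !mxE => <-.
  by congr (A _ _ * (A _ _)^* + A _ _ * (A _ _)^*); apply/val_inj.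
have := (e 0 0, e 1 0, SU2_det A); rewrite /= => -[[e0 e1] d].
split.
  transitivity (A 1 1 * (A 0 0 * (A 0 0)^* + A 0 1 * (A 0 1)^*)
      - A 0 1 * (A 1 0 * (A 0 0)^* + A 1 1 * (A 0 1)^*)).
    by rewrite e0 e1 mulr1 mulr0 subr0.
  by rewrite -[RHS]mul1r -d; ring.
transitivity (A 1 0 * (A 0 0 * (A 0 0)^* + A 0 1 * (A 0 1)^*)
    - A 0 0 * (A 1 0 * (A 0 0)^* + A 1 1 * (A 0 1)^*)).
  by rewrite e0 e1 mulr1 mulr0 subr0.
by rewrite -[RHS]mul1r -d; ring.
Qed.

(* One entry suffices: the second row of a matrix in SU(2) is determined by the
   first. *)
Definition torus : set (SU C 2) := [set A | A 0 1 = 0].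

Definition antitorus : set (SU C 2) := [set A | A 0 0 = 0].

Lemma torus10 A : torus A -> A 1 0 = 0.
Proof. by rewrite /torus /= (SU2_conj A).2 => ->; rewrite conjC0 oppr0. Qed.

Lemma antitorus11 A : antitorus A -> A 1 1 = 0.
Proof. by rewrite /antitorus /= (SU2_conj A).1 => ->; rewrite conjC0. Qed.

Lemma torus_det A : torus A -> A 0 0 * A 1 1 = 1.
Proof. by move=> tA; rewrite -(SU2_det A) tA mul0r subr0. Qed.

Lemma antitorus_det A : antitorus A -> A 0 1 * A 1 0 = - 1.
Proof. by move=> tA; rewrite -(SU2_det A) tA mul0r sub0r opprK. Qed.

Lemma SU2_1E i j : (1 : SU C 2)%g i j = (i == j)%:R.
Proof. by rewrite mxE. Qed.

Lemma torus_inj A B : torus A -> torus B -> A 0 0 = B 0 0 -> A = B.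
Proof.
move=> tA tB AB; apply: SU2_eq => //; first by rewrite tA tB.
  by rewrite !torus10.
by rewrite !(SU2_conj _).1 AB.
Qed.

Lemma torusM A B : torus A -> torus B -> torus (A * B)%g.
Proof. by move=> tA tB; rewrite /torus /= SU2_mulE tA tB mulr0 mul0r addr0. Qed.

Lemma torusV A : torus A -> torus (A^-1)%g.
Proof.
rewrite /torus /= => tA.
have := SU2_mulE A A^-1%g 0 1; rewrite mulgV SU2_1E tA mul0r addr0 => /esym/eqP.
rewrite mulf_eq0 => /orP[/eqP A0|/eqP//].
by have := torus_det tA; rewrite A0 mul0r => /eqP; rewrite eq_sym oner_eq0.
Qed.

Lemma torus_antitorusM A B : torus A -> antitorus B -> antitorus (A * B)%g.
Proof.
by move=> tA aB; rewrite /antitorus /= SU2_mulE tA aB mulr0 mul0r addr0.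
Qed.

Lemma antitorus_torusM A B : antitorus A -> torus B -> antitorus (A * B)%g.
Proof.
move=> aA tB.
by rewrite /antitorus /= SU2_mulE aA (torus10 tB) mulr0 mul0r addr0.
Qed.

Lemma antitorus_divl A B : antitorus A -> antitorus (A * B)%g -> torus B.
Proof.
move=> aA; rewrite /antitorus /= SU2_mulE aA mul0r add0r => /eqP.
rewrite mulf_eq0 => /orP[/eqP A01|/eqP B10].
  have := antitorus_det aA.
  by rewrite A01 mul0r => /eqP; rewrite eq_sym oppr_eq0 oner_eq0.
rewrite /torus /=; have := (SU2_conj B).2.
by rewrite B10 => /esym/eqP; rewrite oppr_eq0 conjC_eq0 => /eqP.
Qed.

Lemma subgroup_torus : subgroup torus.
Proof.
apply/subgroupP; split=> [|A B tA tB]; first by rewrite /torus /= SU2_1E.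
by apply: torusM tA (torusV tB).
Qed.

Lemma torusX A n : torus A -> (A ^+ n)%g 0 0 = A 0 0 ^+ n.
Proof.
move=> tA; elim: n => [|n IHn]; first by rewrite expr0 SU2_1E.
by rewrite expgS SU2_mulE IHn tA mul0r addr0 exprS.
Qed.

Lemma torus_expg1 A n : torus A -> (A ^+ n = 1)%g <-> A 0 0 ^+ n = 1.
Proof.
move=> tA; rewrite -torusX//; split=> [->|An]; first by rewrite SU2_1E.
have sT := subgroup_torus.
apply: torus_inj; [exact: subgroupX | exact: (subgroup1 sT) |].
by rewrite An SU2_1E.
Qed.

Lemma torus_commute A B : torus A -> torus B -> commute A B.
Proof.
move=> tA tB; apply: torus_inj; do ?exact: torusM.
by rewrite !SU2_mulE tA tB !mul0r !addr0 mulrC.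
Qed.

Lemma torus_scalar_commute A B : torus A -> A 0 0 = A 1 1 -> commute A B.
Proof.
move=> tA A01; have A10 := torus10 tA.
by apply: SU2_eq; rewrite !SU2_mulE ?tA ?A10 ?A01; ring.
Qed.

(** The upper right entry of [B * A - A * B] is [B 0 1] times the difference of the two eigenvalues
    of [A]. *)
Lemma torus_centralizer A B :
  torus A -> A 0 0 != A 1 1 -> commute A B -> torus B.
Proof.
move=> tA A01 AB; have := SU2_mulE A B 0 1.
rewrite AB SU2_mulE tA => /eqP; rewrite -subr_eq0.
rewrite (_ : _ - _ = B 0 1 * (A 1 1 - A 0 0)); last by ring.
by rewrite mulf_eq0 subr_eq0 => /orP[/eqP//|]; rewrite eq_sym (negbTE A01).
Qed.

(** The spectral theorem only provides a unitary [P]. Left multiplication by a diagonal unitary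
    matrix corrects its determinant and leaves the diagonal form unchanged. *)
Lemma SU2_diagonalize A : exists g, torus (g * A * g^-1)%g.
Proof.
have uA : (A : 'M_2) \is unitarymx by apply/unitarymxP/SU_unitary.
have nA : (A : 'M_2) \is normalmx.
  by apply/normalmxP; rewrite SU_unitary -invmx_unitary// mulVmx// SU_unitmx.
have := orthomx_spectralP nA.
have := spectral_unitarymx (A : 'M_2).
move: (spectralmx _) (spectral_diag _) => P d uP AE.
have dP : \det P * (\det P)^* = 1.
  have /unitarymxP/(congr1 determinant) := uP.
  by rewrite det_mulmx det_map_mx det_tr det1.
have dP0 : \det P != 0.
  by apply/eqP => P0; move/eqP: dP; rewrite P0 mul0r eq_sym oner_eq0.
(* Only the first row of [P] is rescaled; [T] is unitary because [\det P] has modulus 1. *)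
pose T : 'M[C]_2 := diag_mx (\row_i if i == 0 then (\det P)^-1 else 1).
have uT : T \is unitarymx.
  apply/unitarymxP; rewrite /T tr_diag_mx map_diag_mx mulmx_diag -diag_const_mx.
  congr diag_mx; apply/rowP => i; rewrite !mxE; case: ifP => _.
    by rewrite fmorphV -invfM dP invr1.
  by rewrite rmorph1 mulr1.
have dT : \det T = (\det P)^-1.
  by rewrite /T det_diag !big_ord_recl big_ord0 !mxE /= !mulr1.
have TP : (T *m P \is unitarymx) && (\det (T *m P) == 1).
  by rewrite mul_unitarymx// det_mulmx dT mulVf//= eqxx.
exists (MkSU TP); rewrite /torus /= AE.
have -> : T *m P *m (invmx P *m diag_mx d *m P) = diag_mx d *m (T *m P).
  rewrite !mulmxA mulmxK ?unitarymx_unit//.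
  by rewrite [_ *m diag_mx d]diag_mxC.
by rewrite mulmxK ?(SU_unitmx (MkSU TP))// !mxE.
Qed.

End SU2.

(** * Roots of unity of 2-power order, and recognition of the quaternion group *)

Section Quaternion.
Variable R : realType.
Local Open Scope complex_scope.
Implicit Types (K : set (SU R[i] 2)) (u : R[i]).

Lemma expiX (t : R) n : expi t ^+ n = expi (t *+ n).
Proof.
elim: n => [|n IHn]; first by rewrite expr0 mulr0n /expi cos0 sin0.
rewrite exprS IHn mulrS /expi cosD sinD; apply/eqP; rewrite eq_complex /=.
by rewrite eqxx /= addrC eqxx.
Qed.

Lemma torus_xi n : torus (xi R n).
Proof. by rewrite /torus /= mxE. Qed.

Lemma xi00 n : xi R n 0 0 = expi (2 * pi / n%:R).
Proof. by rewrite mxE. Qed.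

(** The power [2 ^ r] turns the angle into [pi], giving -1, and the next squaring gives 1. *)
Lemma xi_primitive_root r :
  (2 ^ r.+1).-primitive_root (xi R (2 ^ r.+1) 0 0).
Proof.
have n0 k : (2 ^ k)%:R != 0 :> R by rewrite pnatr_eq0 expn_eq0.
rewrite xi00; apply: primitive_root_2X; rewrite expiX -[_ *+ _]mulr_natr.
  rewrite mulfVK// /expi mulr_natl mulr2n cosDpi sinDpi.
  by rewrite cospi sinpi opprK oppr0.
rewrite expnS natrM invfM mulrA [2 * pi * _]mulrAC divff ?pnatr_eq0// mul1r.
rewrite mulfVK// /expi cospi sinpi eq_complex /= eqxx andbT.
by rewrite eq_sym -subr_eq0 opprK -[1 + 1]/2%:R pnatr_eq0.
Qed.

Lemma antitorus_w : antitorus (w R).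
Proof. by rewrite /antitorus /= mxE. Qed.

Lemma torus_existence u : u * u^* = 1 ->
  exists2 A : SU R[i] 2, torus A & A 0 0 = u.
Proof.
move=> uu.
have dU : (mx2 u 0 0 u^* \is unitarymx) && (\det (mx2 u 0 0 u^*) == 1).
  rewrite det_mx2 uu mulr0 subr0 eqxx andbT.
  apply: mx2_unitary;
    by rewrite !(mulr0, mul0r, conjC0, addr0, add0r, conjCK)// mulrC.
by exists (MkSU dU); rewrite /torus /= !mxE.
Qed.

Lemma antitorus_conj_w (A : SU R[i] 2) : antitorus A ->
  exists2 t, torus t & (t * A * t^-1)%g = w R.
Proof.
move=> aA; have [cA01 cA10] := SU2_conj A.
have AA : A 0 1 * (A 0 1)^* = 1.
  by have := antitorus_det aA; rewrite cA10 mulrN => /oppr_inj.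
pose u := sqrtC (- (A 0 1)^*).
have u2 : u ^+ 2 = - (A 0 1)^* by rewrite sqrtCK.
have uu : u * u^* = 1.
  have uu2 : (u * u^*) ^+ 2 = 1.
    by rewrite exprMn -rmorphXn /= u2 rmorphN /= conjCK mulrNN mulrC.
  by apply/eqP; rewrite -(pexpr_eq1 (n := 2))// ?mul_conjC_ge0// uu2.
have [t tt tu] := torus_existence uu; exists t => //.
have [t11 _] := SU2_conj t; have t10 := torus10 tt; have A11 := antitorus11 aA.
suff -> : (t * A = w R * t)%g by rewrite mulgK.
apply: SU2_eq; rewrite !SU2_mulE ?tt ?t10 ?aA ?A11 ?t11 ?tu ?cA10 [w R _ _]mxE
  [w R _ _]mxE /= ?mulr0 ?mul0r ?addr0 ?add0r ?mul1r ?mulN1r//.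
  transitivity ((u * u^*) * (u * A 0 1)); first by rewrite uu mul1r.
  transitivity (u ^+ 2 * (A 0 1 * u^*)); first by ring.
  by rewrite u2 mulNr mulrA [_^* * _]mulrC AA mul1r.
by rewrite -u2 expr2 mulrA [_^* * _]mulrC uu mul1r.
Qed.

(** The least exponent of the form [2 ^ r] killing the diagonal part is attained by some element,
    whose eigenvalue is then a primitive root. The diagonal part and [mu (2 ^ r)] are thus both the
    full group of roots of unity of that order. *)
Lemma torsion_torus K n : subgroup K ->
  (forall A, K A -> torus A -> (A ^+ (2 ^ n) = 1)%g) ->
  (exists2 A, K A & torus A /\ A 0 0 ^+ 2 = - 1) ->
  exists2 r, (2 <= r)%N & K `&` @torus R[i] = mu (2 ^ r).
Proof.
move=> sK Kn [d Kd [td d2]].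
pose P r := `[< forall A, K A -> torus A -> A 0 0 ^+ (2 ^ r) = 1 >].
have exP : exists r, P r.
  by exists n; apply/asboolP => A KA tA; apply/(torus_expg1 _ tA)/Kn.
case: (ex_minnP exP) => -[|r] /asboolP Pr minr.
  have := Pr d Kd td; rewrite expn0 expr1 => d1.
  by move/eqP: d2; rewrite d1 expr1n -subr_eq0 opprK -[1 + 1]/2%:R pnatr_eq0.
(* The exponent is now [r.+1]. Exponent 0 was excluded above and exponent 1 is excluded here, both
   by the eigenvalue of [d], whose square is -1. *)
have r_gt0 : (0 < r)%N.
  case: r Pr {minr} => // Pr; have /eqP := Pr d Kd td.
  by rewrite expn1 d2 eq_sym -subr_eq0 opprK -[1 + 1]/2%:R pnatr_eq0.
exists r.+1 => //.
have [a [Ka ta a1]] : exists a, [/\ K a, torus a & a 0 0 ^+ (2 ^ r) != 1].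
  apply: contrapT => noa; have /minr : P r; last by rewrite ltnn.
  apply/asboolP => A KA tA; apply/eqP/negPn/negP => A1.
  by case: noa; exists A.
have aprim := primitive_root_2X (Pr a Ka ta) a1.
have xiprim := xi_primitive_root r.
apply/seteqP; split=> [A [KA tA] M [sM xiM]|].
  have [k Ak] := prim_rootP xiprim (Pr A KA tA).
  have -> : A = (xi R (2 ^ r.+1) ^+ k)%g.
    apply: torus_inj => //; last by rewrite torusX ?Ak//; apply: torus_xi.
    exact: (subgroupX _ (subgroup_torus _) (torus_xi _)).
  by apply: subgroupX => //; apply: xiM.
apply: smallest_sub => [|_ ->].
  apply/subgroupP; split=> [|A B [KA tA] [KB tB]].
    by split; [exact: subgroup1 sK | exact: subgroup1 (subgroup_torus _)].
  split; first exact: subgroupM sK KA (subgroupV sK KB).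
  exact: torusM tA (torusV tB).
split; last exact: torus_xi.
have [k xik] := prim_rootP aprim (prim_expr_order xiprim).
rewrite (_ : xi R _ = a ^+ k)%g; first exact: subgroupX.
apply: torus_inj; [exact: torus_xi | | by rewrite torusX].
exact: (subgroupX _ (subgroup_torus _) ta).
Qed.

(** Conjugation by [h] swaps the two eigenvalues of [A], which are inverse to each other. The proof
    checks the equivalent identity [A * h * A = h], free of inverses. *)
Lemma torus_conj_antitorus (A h : SU R[i] 2) :
  torus A -> antitorus h -> (A ^ h = A^-1)%g.
Proof.
move=> tA ah; rewrite conjgE; apply: (mulgI h); rewrite mulgA mulgV mul1g.
apply: (mulIg A); rewrite -[RHS]mulgA mulVg mulg1.
have A10 := torus10 tA; have h11 := antitorus11 ah.
have AA := torus_det tA.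
apply: SU2_eq; rewrite !SU2_mulE ?tA ?A10 ?ah ?h11;
  rewrite ?(mulr0, mul0r, addr0, add0r)//.
  by rewrite mulrAC AA mul1r.
by rewrite mulrAC [A 1 1 * _]mulrC AA mul1r.
Qed.

(** If [z] had distinct eigenvalues, its centralizer would be conjugate into the diagonal matrices,
    and [x] and [y] would commute. Hence [z] is scalar, and determinant 1 leaves only the two
    signs. *)
Lemma center_scalar (z x y : SU R[i] 2) :
  commute z x -> commute z y -> ~ commute x y ->
  (forall A, commute z A) /\
  exists2 e : R[i], e = 1 \/ e = - 1 & forall A i j, (A * z)%g i j = e * A i j.
Proof.
move=> zx zy xy; have [g tz] := SU2_diagonalize z.
have cJ a b : commute a b -> commute (g * a * g^-1)%g (g * b * g^-1)%g.
  by move=> ab; rewrite /commute !mulgA !mulgVK -!(mulgA g) ab.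
have [z01|z01] := eqVneq ((g * z * g^-1)%g 0 0) ((g * z * g^-1)%g 1 1);
    last first.
  case: xy; have /torus_commute : torus (g * x * g^-1)%g.
    exact: torus_centralizer tz z01 (cJ _ _ zx).
  move/(_ (g * y * g^-1)%g (torus_centralizer tz z01 (cJ _ _ zy))).
  rewrite /commute !mulgA !mulgVK => /mulIg; rewrite -!mulgA.
  by move/mulgI.
have zE : z = (g * z * g^-1)%g.
  apply: (mulgI g); rewrite -(torus_scalar_commute g tz z01).
  by rewrite mulgVK.
rewrite -zE in tz z01; split=> [A|]; first exact: torus_scalar_commute.
exists (z 0 0).
  have := torus_det tz; rewrite -z01 -expr2 => /eqP.
  by rewrite sqrf_eq1 => /orP[] /eqP; [left | right].
have z10 := torus10 tz.
move=> A i j; rewrite SU2_mulE.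
by case: (ord2 j) => ->; rewrite ?tz ?z10 -?z01; ring.
Qed.

(** For [e = - 1], the (0,0) entry forces [k 0 0 = 0]. Then [k 0 1] is nonzero, so the (0,1) entry
    makes the eigenvalues of [x] opposite, while their product is 1. *)
Lemma torus_sign_commute (x k : SU R[i] 2) (e : R[i]) :
  torus x -> x 0 0 != x 1 1 -> e = 1 \/ e = - 1 ->
  (forall i j, (x * k)%g i j = e * (k * x)%g i j) ->
  torus k \/ antitorus k /\ x 0 0 ^+ 2 = - 1.
Proof.
move=> tx x01 [] -> xk.
  left; apply: torus_centralizer tx x01 _.
  by apply: SU2_eq; rewrite xk mul1r.
right; have x10 := torus10 tx; have xx := torus_det tx.
have x0 : x 0 0 != 0.
  by apply/eqP => x0; move/eqP: xx; rewrite x0 mul0r eq_sym oner_eq0.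
have ak : antitorus k.
  have /eqP := xk 0 0; rewrite !SU2_mulE tx x10 -subr_eq0.
  rewrite (_ : _ - _ = x 0 0 * k 0 0 *+ 2); last by ring.
  by rewrite mulrn_eq0 mulf_eq0 (negbTE x0) => /eqP.
split=> //; have /eqP := xk 0 1.
rewrite !SU2_mulE tx ak -subr_eq0.
rewrite (_ : _ - _ = k 0 1 * (x 0 0 + x 1 1)); last by ring.
rewrite mulf_eq0 addr_eq0 => /orP[/eqP k01|/eqP x00].
  by have /eqP := antitorus_det ak; rewrite k01 mul0r eq_sym oppr_eq0 oner_eq0.
by rewrite expr2 {2}x00 mulrN xx.
Qed.

(** A diagonal [t] moves an antidiagonal element of [K] to [w] and fixes every diagonal element. The
    diagonal part is then some [mu (2 ^ r)], and the antidiagonal part is its coset by [w]. *)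
Lemma quaternion_recognition K n : subgroup K ->
  K `<=` @torus R[i] `|` @antitorus R[i] ->
  (forall a h, K a -> K h -> (a ^ h = a^-1)%g -> (a ^+ (2 ^ n) = 1)%g) ->
  (exists2 A, K A & torus A /\ A 0 0 ^+ 2 = - 1) ->
  (exists2 A, K A & antitorus A) ->
  exists r, (2 <= r)%N /\ exists t, conj_image t K = gen_quaternion r.
Proof.
move=> sK KN Kn [d Kd [td d2]] [h Kh ah].
have [t tt hw] := antitorus_conj_w ah.
pose L := conj_image t K.
have sL : subgroup L := subgroup_conj_image t sK.
have tJ A : torus A -> torus (t * A * t^-1)%g.
  by move=> tA; do 2?apply: torusM => //; apply: torusV.
have Lw : L (w R) by exists h.
have Ld : L d by exists d => //; rewrite (torus_commute tt td) mulgK.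
have LN : L `<=` @torus R[i] `|` @antitorus R[i].
  move=> _ [A /KN[tA|aA] <-]; [left; exact: tJ | right].
  by apply: antitorus_torusM (torusV tt); apply: torus_antitorusM.
have Ln A : L A -> torus A -> (A ^+ (2 ^ n) = 1)%g.
  move=> LA tA.
  have [B KB BA] := LA.
  have tB : torus B.
    have -> : B = (t^-1 * A * t)%g by rewrite -BA !mulgA mulVg mul1g mulgVK.
    by do 2?apply: torusM => //; apply: torusV.
  have -> : A = B by rewrite -BA (torus_commute tt tB) mulgK.
  exact: Kn KB Kh (torus_conj_antitorus tB ah).
have [r r2 LE] := torsion_torus sL Ln (ex_intro2 _ _ d Ld (conj td d2)).
exists r; split=> //; exists t.
rewrite /gen_quaternion -/L -LE; apply/seteqP.
split=> [A LA|A [[]//|[B [LB _] <-]]].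
  have [tA|aA] := LN A LA; first by left.
  right; exists ((w R)^-1 * A)%g; last by rewrite mulgA mulgV mul1g.
  split; first exact: subgroupM sL (subgroupV sL Lw) LA.
  by apply: antitorus_divl (antitorus_w) _; rewrite mulgA mulgV mul1g.
by apply: subgroupM sL Lw LB.
Qed.

End Quaternion.

Theorem proposition1 (R : realType) (H : set (SU R[i] 2)) :
  subgroup H -> nilpotent_subgroup H ->
  abelian_subgroup H \/
  exists r : nat, (2 <= r)%N /\
    exists g : SU R[i] 2, conj_image g H = gen_quaternion r.
Proof.
move=> sH nH; have [abH|nabH] := pselect (abelian_subgroup H); first by left.
right; have [x [h [Hx Hh xh cH]]] := nilpotent_second_center sH nH nabH.
have [n Hn] := nilpotent_inverted_torsion sH nH.
have [g tX] := SU2_diagonalize x.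
pose f a := (a ^ g^-1)%g.
have fE a : f a = (g * a * g^-1)%g by rewrite /f conjgE invgK mulgA.
have fM a b : f (a * b)%g = (f a * f b)%g := conjMg a b g^-1%g.
have f_inj : injective f := @conjg_inj _ g^-1%g.
rewrite -fE in tX.
(* A scalar [f x] would be central, contradicting that [x] and [h] do not commute. *)
have X01 : f x 0 0 != f x 1 1.
  apply/eqP => X01; apply/xh/eqP/commgP/f_inj; rewrite !fM.
  exact: torus_scalar_commute.
have fN k : H k -> torus (f k) \/ antitorus (f k) /\ f x 0 0 ^+ 2 = - 1.
  move=> Hk; have xhN : ~ commute x h by move=> /commgP/eqP.
  have [cC [e e1 ce]] := center_scalar (cH k x Hk Hx) (cH k h Hk Hh) xhN.
  (* The commutator is central in all of SU(2), so the diagonalizing conjugation preserves it and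
     [f x], [f k] commute up to the sign [e]. *)
  have fc : f [~ x, k]%g = [~ x, k]%g by apply/conjg_fixP/commgP/cC.
  apply: (torus_sign_commute tX X01 e1) => i j.
  by rewrite -!fM [(x * k)%g]commgC (fM (k * x)%g) fc ce.
(* Since [f x] is diagonal and does not commute with [f h], the latter is antidiagonal. This one
   case supplies both the antidiagonal element and the eigenvalue of square -1. *)
have [tfh|[afh x2]] := fN h Hh.
  case: xh; apply/eqP/commgP/f_inj; rewrite !fM.
  exact: torus_commute.
have fK a : H a -> conj_image g H (f a) by move=> Ha; exists a.
have [|||||r [r2 [t tE]]] := @quaternion_recognition R (conj_image g H) n.
- exact: subgroup_conj_image.
- by move=> _ [k /fN + <-]; rewrite -fE => -[?|[? _]]; [left | right].
- move=> _ _ [a Ha <-] [b Hb <-]; rewrite -!fE -conjJg -conjVg => /f_inj ab.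
  by rewrite -conjXg (Hn a b)// conj1g.
- by exists (f x); [exact: fK|].
- by exists (f h); [exact: fK|].
- by exists r; split=> //; exists (t * g)%g; rewrite -conj_imageM.
Qed.
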